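(* Let $a,c,d$ be positive integers, not all equal to $1$, such that $\gcd(a,c,d)=1$ and $2a=c+d$; set $M:=2a=c+d$ (so $c\ne d$), and let $q$ be the additive order of $c$ modulo $M$. \begin{enumerate} \item If $q$ is odd, then there are no $(a,a,c,d)$-hitomezashi patterns. \item If $q$ is even, then every $(a,a,c,d)$-hitomezashi pattern consists of a combination of rectangles and horizontal accordions (and the $(a,a,c,d)$-hitomezashi patterns are exactly those of the form $\psi(\vec y)$ with $\vec y\in\mathcal Y_{(a,c,d)}$, for the bijective parameterization $\psi$ defined in the context), and the set of all such patterns has the cardinality $2^{\aleph_0}$ of the continuum. \end{enumerate}
   Context: For $u,v\in\mathbb R^2$, $[u,v]$ is the line segment with endpoints $u,v$. Let $a,b,c,d$ be positive integers. Assign to each $i\in\mathbb Z$ a label $\varepsilon_i\in\mathbb Z/(a+b)\mathbb Z$ and to each $j\in\mathbb Z$ a label $\eta_j\in\mathbb Z/(c+d)\mathbb Z$. The horizontal stitches on the line $y=i$ are the segments $[(k,i),(k+a,i)]$ with $k\equiv\varepsilon_i\pmod{a+b}$; the vertical stitches on the line $x=j$ are the segments $[(j,k),(j,k+c)]$ with $k\equiv\eta_j\pmod{c+d}$. The resulting arrangement of stitches is an $(a,b,c,d)$-hitomezashi pattern if every endpoint of a vertical stitch is an endpoint of a horizontal stitch and vice versa. Here $b=a$. View the stitches as edges of a graph whose vertices are the endpoints of stitches; its connected components are called strands. A rectangle is a strand that is a cycle consisting of four stitches. A horizontal accordion is an infinite strand that can be oriented so that its stitches are alternately (cyclically) oriented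 south-to-north, west-to-east, north-to-south, and west-to-east. Parameterization $\psi$ (for $q$ even): let $\mathcal Y_{(a,c,d)}:=\{0,1\}^{M/q}\times\{0,1\}^{\mathbb Z}\times S_{M/2}$, where $S_n$ is the set of permutations of $\{1,\dots,n\}$. For $\vec y=((u_1,\dots,u_{M/q}),(v_i)_{i\in\mathbb Z},\sigma)\in\mathcal Y_{(a,c,d)}$ and $1\le i\le M/q$, let $\hat u(i)$ be the sequence $i+u_ic,\ i+(u_i+2)c,\dots,i+(u_i+q-2)c$, and let $\widetilde u=\widetilde u_1\cdots\widetilde u_{M/2}$ be the concatenation $\hat u(1)\hat u(2)\cdots\hat u(M/q)$ (note $M/2=a$). Then $\psi(\vec y)$ is the $(a,a,c,d)$-hitomezashi pattern such that: (i) the set of south endpoints of vertical stitches is $\{(1,\widetilde u_{\sigma(1)}),(2,\widetilde u_{\sigma(2)}),\dots,(a,\widetilde u_{\sigma(a)})\}+(a\mathbb Z\times M\mathbb Z)$ (this determines the set of endpoints of stitches); (ii) for each latitude $i\in\mathbb Z$, of the two placements of horizontal stitches on $y=i$ consistent with the vertical stitches, one has a horizontal stitch whose west endpoint has $x$-coordinate in $[0,a-1]$ and the other has a horizontal stitch whose west endpoint has $x$-coordinate in $[a,M-1]$; the former is used if $v_i=0$ and the latter if $v_i=1$. *)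

(* Defs.v *)
From Stdlib Require Import Relation_Operators.
From mathcomp Require Import all_boot all_order all_algebra all_fingroup.
From mathcomp Require Import mathcomp_extra boolp classical_sets functions.
From mathcomp Require Import cardinality.

Set Implicit Arguments.
Unset Strict Implicit.
Unset Printing Implicit Defensive.

Import Order.TTheory GRing.Theory Num.Theory.
Local Open Scope classical_set_scope.
Local Open Scope ring_scope.

Definition vertex : Type := (int * int)%type.

(* The segment [u, v] is represented by the set of its two endpoints, which
   determines it; this is also the corresponding edge of the graph of
   stitches. *)
Definition segment : Type := set vertex.
Definition seg (u v : vertex) : segment := [set u; v].

Definition arrangement : Type := set segment.

Definition endpoints (A : arrangement) : set vertex := \bigcup_(e in A) e.

Section Stitches.
Variables a b c d : nat.

(* 'Z_n is Z/nZ only for n >= 2, which holds for n = a + b and n = c + d as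
   soon as a, b, c, d are positive. *)
Definition horizontal_stitches (eps : int -> 'Z_(a + b)) : arrangement :=
  [set e | exists k i : int, k%:~R = eps i /\ e = seg (k, i) (k + a%:Z, i)].

Definition vertical_stitches (eta : int -> 'Z_(c + d)) : arrangement :=
  [set e | exists k j : int, k%:~R = eta j /\ e = seg (j, k) (j, k + c%:Z)].

Definition hitomezashi (P : arrangement) : Prop :=
  exists (eps : int -> 'Z_(a + b)) (eta : int -> 'Z_(c + d)),
    P = horizontal_stitches eps `|` vertical_stitches eta /\
    endpoints (vertical_stitches eta) = endpoints (horizontal_stitches eps).

End Stitches.

Definition connected_in (P : arrangement) : vertex -> vertex -> Prop :=
  clos_refl_trans vertex (fun u v => P (seg u v)).

(* A connected component of the graph, given by its set of edges; no vertex is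
   isolated, so nothing is lost. *)
Definition strand (P S : arrangement) : Prop :=
  exists2 u, endpoints P u &
    S = [set e | P e /\ exists2 v, e v & connected_in P u v].

Definition rectangle (S : arrangement) : Prop :=
  exists s : seq vertex, [/\ uniq s, size s = 4%N &
    S = [set e | exists2 u, u \in s & e = seg u (next s u)]].

Definition south_to_north (u v : vertex) : Prop := u.1 = v.1 /\ u.2 < v.2.
Definition north_to_south (u v : vertex) : Prop := u.1 = v.1 /\ v.2 < u.2.
Definition west_to_east (u v : vertex) : Prop := u.2 = v.2 /\ u.1 < v.1.

(* The orientation is recorded by a bi-infinite walk f that traverses the
   stitches of S from f n to f (n + 1). *)
Definition horizontal_accordion (S : arrangement) : Prop :=
  infinite_set S /\
  exists f : int -> vertex,
    S = range (fun n => seg (f n) (f (n + 1))) /\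
    forall n : int,
      [/\ south_to_north (f (4 * n)) (f (4 * n + 1)),
          west_to_east (f (4 * n + 1)) (f (4 * n + 2)),
          north_to_south (f (4 * n + 2)) (f (4 * n + 3)) &
          west_to_east (f (4 * n + 3)) (f (4 * n + 4))].

(* The finGroupType structure of 'Z_M is the additive one. *)
Definition additive_order (M c : nat) : nat := #[c%:R : 'Z_M]%g.

Section Parameterization.
Variables a c : nat.

Let M := (2 * a)%N.
Let q := additive_order M c.

(* Here M / 2 = a.  Elements 1, ..., n are represented by 0, ..., n - 1 in
   'I_n, whence the occurrences of i.+1 and j.+1 below. *)
Definition parameter : Type :=
  ({ffun 'I_(M %/ q) -> bool} * (int -> bool) * 'S_a)%type.

Definition uhat (u : {ffun 'I_(M %/ q) -> bool}) (i : 'I_(M %/ q)) : seq nat :=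
  [seq (i.+1 + (u i + 2 * k) * c)%N | k <- iota 0 (q %/ 2)].

Definition utilde (u : {ffun 'I_(M %/ q) -> bool}) : seq nat :=
  flatten [seq uhat u i | i <- enum 'I_(M %/ q)].

Definition south_endpoints (P : arrangement) : set vertex :=
  [set p | P (seg p (p.1, p.2 + c%:Z))].

(* The clauses (i) and (ii) that characterize the pattern psi(u, v, sigma). *)
Definition psi_spec (d : nat) (y : parameter) (P : arrangement) : Prop :=
  let: (u, v, sigma) := y in
  [/\ hitomezashi a a c d P,
      south_endpoints P =
        [set p | exists (j : 'I_a) (s t : int),
           p = (j.+1%:Z + a%:Z * s, (nth 0%N (utilde u) (sigma j))%:Z + M%:Z * t)] &
      forall i : int, exists x : int,
        (if v i then a%:Z <= x <= M%:Z - 1 else 0 <= x <= a%:Z - 1) /\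
        P (seg (x, i) (x + a%:Z, i))].

(* "The" pattern satisfying psi_spec; it is meaningful only when it exists and
   is unique, which has to be proved. *)
Definition psi (d : nat) (y : parameter) : arrangement :=
  get (psi_spec d y : set arrangement).

End Parameterization.

(* Main.v *)
Require Import Defs.
From Stdlib Require Import Relation_Operators.
From mathcomp Require Import all_boot all_order all_algebra all_fingroup.
From mathcomp Require Import mathcomp_extra boolp classical_sets functions.
From mathcomp Require Import cardinality cyclic zify ring.

Set Implicit Arguments.
Unset Strict Implicit.
Unset Printing Implicit Defensive.

Import Order.TTheory GRing.Theory Num.Theory.
Local Open Scope classical_set_scope.
Local Open Scope card_scope.

(** Lift all labels to integers: a pattern is given by the residues modulo M = 2a
    of the west ends E y on the rows and of the south ends F x on the columns. As
    the horizontal stitches and the gaps have the same length a, the endpoints on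
    row y are all the x congruent to E y modulo a, and the condition on endpoints
    says that this holds exactly when y is F x or F x + c modulo M
    ([hitomezashiP]).

    Columns congruent modulo a therefore carry the same endpoints, and because
    2c is not 0 modulo M they have the same south residue ([matching_periodic]).
    It follows that the set H of the residues of south ends and its translate
    H + c partition Z/M ([south_row_subc]). Translating q times by c, where q is
    the order of c, is the identity but changes sides q times, so q is even: this
    is the first part.

    When q is even, the gcd condition forces c to be odd and coprime to M, so
    q = M ([order_column_length]). In the coordinate m of a residue 1 + m c, the
    set H consists of the m of one parity u, and the a columns modulo a reach the
    a elements of H once each, in an order sigma ([south_columns_ex]). Then E is
    determined modulo a, and the choice v of one of its two lifts modulo 2a is
    free on each row. Conversely all such data define a pattern
    ([matching_ex]), so the parameters (u, v, sigma) classify the patterns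
    ([psi_bij]), and v alone accounts for the cardinality of the continuum.

    For the strands, let i be in H. The vertical stitches between rows i and
    i + c stand on all columns of one class modulo a, and they contain all
    endpoints of both rows.
    The horizontal stitches of row i are thus either straight below those of
    row i + c, which gives rectangles, or below their gaps, which gives an
    accordion ([pattern_strand]). *)

(** * Stitches and congruences *)

Section Segments.
Local Open Scope ring_scope.

(** Segments are unordered pairs of endpoints, so a segment is recovered only up
    to the swap of its ends; for stitches, whose direction and length are
    prescribed, the south or west end is determined. *)
Lemma seg_inj (u v u' v' : vertex) :
  seg u v = seg u' v' -> u = u' /\ v = v' \/ u = v' /\ v = u'.
Proof.
move=> e.
have uP : seg u' v' u by rewrite -e; left.
have vP : seg u' v' v by rewrite -e; right.
have u'P : seg u v u' by rewrite e; left.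
have v'P : seg u v v' by rewrite e; right.
by case: uP; case: vP; case: u'P; case: v'P => *; subst; auto.
Qed.

Lemma segC (u v : vertex) : seg u v = seg v u.
Proof. exact: setUC. Qed.

Lemma horizontal_seg_inj (a : nat) (x y x' y' : int) : (0 < a)%N ->
  seg (x, y) (x + a%:Z, y) = seg (x', y') (x' + a%:Z, y') -> x = x' /\ y = y'.
Proof. by move=> a0 /seg_inj[] [[? ?] [? ?]]; lia. Qed.

Lemma vertical_seg_inj (c : nat) (x y x' y' : int) : (0 < c)%N ->
  seg (x, y) (x, y + c%:Z) = seg (x', y') (x', y' + c%:Z) -> x = x' /\ y = y'.
Proof. by move=> a0 /seg_inj[] [[? ?] [? ?]]; lia. Qed.

Lemma horizontal_seg_neq_vertical (a c : nat) (x y x' y' : int) : (0 < a)%N ->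
  seg (x, y) (x + a%:Z, y) <> seg (x', y') (x', y' + c%:Z).
Proof. by move=> a0 /seg_inj[] [[? ?] [? ?]]; lia. Qed.

End Segments.

Section Congruences.
Local Open Scope ring_scope.

(** This is how every congruence between bounded quantities becomes an
    equality. *)
Lemma dvdz_small (m : nat) (z : int) : (m%:Z %| z)%Z -> `|z| < m%:Z -> z = 0.
Proof.
move=> /dvdzP[k ->]; rewrite normrM => lt_m; case: (k =P 0) => [->|k0]; nia.
Qed.

Lemma dvdz_congr (m : nat) (u v : int) :
  (m%:Z %| u - v)%Z -> (m%:Z %| u)%Z = (m%:Z %| v)%Z.
Proof.
rewrite -eqz_mod_dvd => /eqP uv.
by apply/dvdz_mod0P/dvdz_mod0P; rewrite uv.
Qed.

Lemma eqr_int_Zp (n : nat) (k l : int) : (1 < n)%N ->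
  (k%:~R = l%:~R :> 'Z_n) <-> (n%:Z %| k - l)%Z.
Proof.
move=> n1.
have H (m : nat) : (m%:R = 0 :> 'Z_n) <-> (n %| m)%N.
  rewrite Zp_nat /dvdn; split => [/(congr1 val) /=|/eqP mn].
    by rewrite Zp_cast // => ->.
  by apply/val_inj; rewrite /= Zp_cast.
rewrite dvdzE /=; rewrite -H.
have -> : (k%:~R = l%:~R :> 'Z_n) <-> ((k - l)%:~R = 0 :> 'Z_n).
  by rewrite rmorphB /=; split => [->|/subr0_eq//]; rewrite subrr.
case: (k - l) => m //; rewrite NegzE abszN rmorphN /=.
rewrite [(Posz _)%:~R](_ : _ = m.+1%:R) //.
by split => [|->]; [rewrite -[in X in _ -> X](opprK m.+1%:R) => ->|];
  rewrite oppr0.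
Qed.

End Congruences.

(** * Patterns in terms of integer residues *)

Section Patterns.
Local Open Scope ring_scope.
Variables a c : nat.
Local Notation M := (2 * a)%N.

Definition horizontal_arrangement (E : int -> int) : arrangement :=
  [set e | exists x y : int,
     (M%:Z %| x - E y)%Z /\ e = seg (x, y) (x + a%:Z, y)].

Definition vertical_arrangement (F : int -> int) : arrangement :=
  [set e | exists x y : int,
     (M%:Z %| y - F x)%Z /\ e = seg (x, y) (x, y + c%:Z)].

(** A stitch pattern with its labels lifted to integers: on row y the west ends
    are the x congruent to E y, on column x the south ends are the y congruent to
    F x, both modulo M = 2a. *)
Definition pattern (E F : int -> int) : arrangement :=
  horizontal_arrangement E `|` vertical_arrangement F.

(** Equality of the two sets of endpoints, by [matchingP]. On row y the ends of
    horizontal stitches are the classes of E y and E y + a modulo M = 2a, which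
    together form one class modulo a. *)
Definition matching (E F : int -> int) : Prop := forall x y : int,
  (a%:Z %| x - E y)%Z = (M%:Z %| y - F x)%Z || (M%:Z %| y - F x - c%:Z)%Z.

Lemma dvdz_half (z : int) :
  (a%:Z %| z)%Z = (M%:Z %| z)%Z || (M%:Z %| z - a%:Z)%Z.
Proof.
apply/idP/orP => [/dvdzP[k ->]|[] /dvdzP[k e]]; last 2 first.
- by apply/dvdzP; exists (2 * k); lia.
- by apply/dvdzP; exists (2 * k + 1); lia.
have [h|h] : k = 2 * (k %/ 2)%Z \/ k = 2 * (k %/ 2)%Z + 1 by lia.
- by left; apply/dvdzP; exists (k %/ 2)%Z; rewrite {1}h; lia.
- by right; apply/dvdzP; exists (k %/ 2)%Z; rewrite {1}h; lia.
Qed.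

Lemma endpoints_horizontal (E : int -> int) :
  endpoints (horizontal_arrangement E) =
  [set p | (a%:Z %| p.1 - E p.2)%Z].
Proof.
apply/seteqP; split => [p [e [x [y [xy ->]]]]|[x y] /=].
  case=> -> /=; rewrite dvdz_half; apply/orP; [by left|right].
  by rewrite addrAC addrK.
rewrite dvdz_half => /orP[h|h].
  by exists (seg (x, y) (x + a%:Z, y)); [exists x, y|left].
exists (seg (x - a%:Z, y) (x - a%:Z + a%:Z, y)).
  by exists (x - a%:Z), y; rewrite addrAC.
by right; rewrite subrK.
Qed.

Lemma endpoints_vertical (F : int -> int) :
  endpoints (vertical_arrangement F) =
  [set p | (M%:Z %| p.2 - F p.1)%Z || (M%:Z %| p.2 - F p.1 - c%:Z)%Z].
Proof.
apply/seteqP; split => [p [e [x [y [xy ->]]]]|[x y] /=].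
  case=> -> /=; apply/orP; [by left|right].
  by rewrite addrAC addrK.
move=> /orP[h|h].
  by exists (seg (x, y) (x, y + c%:Z)); [exists x, y|left].
exists (seg (x, y - c%:Z) (x, y - c%:Z + c%:Z)).
  by exists x, (y - c%:Z); rewrite addrAC.
by right; rewrite subrK.
Qed.

Lemma matchingP (E F : int -> int) :
  endpoints (vertical_arrangement F) = endpoints (horizontal_arrangement E) <->
  matching E F.
Proof.
rewrite endpoints_horizontal endpoints_vertical; split.
  by move=> /seteqP[FE EF] x y; apply/idP/idP => [/(EF (x, y))|/(FE (x, y))].
by move=> EF; apply/seteqP; split => -[x y]; rewrite /= EF.
Qed.

Section Membership.
Hypotheses (a0 : (0 < a)%N) (c0 : (0 < c)%N).

Lemma pattern_horizontal (E F : int -> int) (x y : int) :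
  pattern E F (seg (x, y) (x + a%:Z, y)) <-> (M%:Z %| x - E y)%Z.
Proof.
split=> [[[x' [y' [h e]]]|[x' [y' [_ e]]]]|h].
- by have [-> ->] := horizontal_seg_inj a0 e.
- by case: (horizontal_seg_neq_vertical a0 e).
- by left; exists x, y.
Qed.

Lemma pattern_vertical (E F : int -> int) (x y : int) :
  pattern E F (seg (x, y) (x, y + c%:Z)) <-> (M%:Z %| y - F x)%Z.
Proof.
split=> [[[x' [y' [_ e]]]|[x' [y' [h e]]]]|h].
- by case: (horizontal_seg_neq_vertical a0 (esym e)).
- by have [-> ->] := vertical_seg_inj c0 e.
- by right; exists x, y.
Qed.

End Membership.

(** Stitches on one line start in a fixed class modulo M and are shorter than M,
    so they are disjoint. *)
Lemma horizontal_stitch_unique (E : int -> int) (v : vertex)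
    (e e' : segment) : (0 < a)%N ->
  horizontal_arrangement E e -> horizontal_arrangement E e' ->
  e v -> e' v -> e = e'.
Proof.
move=> a0 [x [y [/dvdzP[k ek] ->]]] [x' [y' [/dvdzP[l el] ->]]].
have far : x - x' = 0 \/ x - x' = a%:Z \/ x' - x = a%:Z -> y = y' -> x = x'.
  move=> h yy'; rewrite yy' in ek; suff : x - x' = 0 by lia.
  by apply: (@dvdz_small M); [apply/dvdzP; exists (k - l)|]; lia.
case=> -> [] [] *; have -> : y = y' by [].
all: by have -> : x = x' by apply: far; lia.
Qed.

Lemma vertical_stitch_unique (F : int -> int) (v : vertex)
    (e e' : segment) : (0 < c)%N -> (c < M)%N ->
  vertical_arrangement F e -> vertical_arrangement F e' ->
  e v -> e' v -> e = e'.
Proof.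
move=> c0 cM [x [y [/dvdzP[k ek] ->]]] [x' [y' [/dvdzP[l el] ->]]].
have far : y - y' = 0 \/ y - y' = c%:Z \/ y' - y = c%:Z -> x = x' -> y = y'.
  move=> h xx'; rewrite xx' in ek; suff : y - y' = 0 by lia.
  by apply: (@dvdz_small M); [apply/dvdzP; exists (k - l)|]; lia.
case=> -> [] [] *; have -> : x = x' by [].
all: by have -> : y = y' by apply: far; lia.
Qed.

Lemma eq_pattern (E E' F F' : int -> int) :
  (forall y, (M%:Z %| E y - E' y)%Z) -> (forall x, (M%:Z %| F x - F' x)%Z) ->
  pattern E F = pattern E' F'.
Proof.
move=> hE hF; have sw (x y z : int) : (M%:Z %| y - z)%Z ->
    (M%:Z %| x - y)%Z = (M%:Z %| x - z)%Z.
  move=> h; apply/esym/dvdz_congr.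
  by have <- : y - z = x - z - (x - y) by ring.
rewrite /pattern; congr (_ `|` _); apply/seteqP; split => e [x [y [xy ->]]];
  exists x, y; split => //; move: xy;
  by rewrite ?(sw _ _ _ (hE y)) ?(sw _ _ _ (hF x)).
Qed.

(** The labels in Z/(a+a) and Z/(c+d), which are both Z/M, may be lifted to
    arbitrary integer representatives. *)
Lemma hitomezashiP (d : nat) (P : arrangement) :
  (0 < a)%N -> (2 * a = c + d)%N ->
  hitomezashi a a c d P <->
  exists E F : int -> int, P = pattern E F /\ matching E F.
Proof.
move=> a0 hM.
have hE (E : int -> int) : horizontal_arrangement E =
    horizontal_stitches (fun y => (E y)%:~R : 'Z_(a + a)).
  by apply/seteqP; split => e [x [y [xy ->]]]; exists x, y; split => //;
    move: xy; rewrite eqr_int_Zp; try lia; rewrite mul2n addnn.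
have hF (F : int -> int) : vertical_arrangement F =
    vertical_stitches (fun x => (F x)%:~R : 'Z_(c + d)).
  apply/seteqP; split => e [x [y [xy ->]]]; [exists y, x|exists y, x];
    split => //; move: xy; rewrite eqr_int_Zp; try lia; rewrite hM //.
split => [[eps [eta [-> eq_ends]]]|[E [F [-> /matchingP eq_ends]]]].
  have defE : eps = (fun y => (eps y : nat)%:Z%:~R).
    by apply/funext => y; rewrite [RHS]natr_Zp.
  have defF : eta = (fun x => (eta x : nat)%:Z%:~R).
    by apply/funext => x; rewrite [RHS]natr_Zp.
  exists (fun y => (eps y : nat)%:Z), (fun x => (eta x : nat)%:Z).
  by rewrite -matchingP /pattern hE hF -defE -defF.
exists (fun y => (E y)%:~R), (fun x => (F x)%:~R).
by rewrite -hE -hF.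
Qed.

End Patterns.

(** * The south ends modulo M and the order of c *)

Section Matchings.
Local Open Scope ring_scope.
Variables a c d : nat.
Local Notation M := (2 * a)%N.
Hypotheses (c0 : (0 < c)%N) (d0 : (0 < d)%N) (hM : (M = c + d)%N).

Lemma dvdz_order (n : nat) :
  (additive_order M c %| n)%N = (M%:Z %| n%:Z * c%:Z)%Z.
Proof.
rewrite order_dvdn FinRing.zmodXgE.
have -> : (c%:R *+ n == 1%g :> 'Z_M) = ((n%:Z * c%:Z)%:~R == 0%:~R :> 'Z_M).
  by rewrite rmorphM /= mulr_natl.
have M1 : (1 < M)%N by lia.
have [to_dvd of_dvd] := eqr_int_Zp (n%:Z * c%:Z) 0 M1.
rewrite subr0 in to_dvd of_dvd.
by apply/eqP/idP => [/to_dvd|/of_dvd].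
Qed.

Section Columns.
Hypothesis ca : c <> a.
Variables E F : int -> int.
Hypothesis hEF : matching a c E F.

(** The endpoints on a row are a-periodic, so columns x and x' carry the same
    set of endpoints {F x, F x + c} = {F x', F x' + c}. If F x were not F x',
    then 2c would vanish modulo M = 2a, although 0 < c < M and c differs
    from a. *)
Lemma matching_periodic (x x' : int) :
  (a%:Z %| x - x')%Z -> (M%:Z %| F x - F x')%Z.
Proof.
move=> xx'; have row (y : int) : (a%:Z %| x - E y)%Z = (a%:Z %| x' - E y)%Z.
  by apply: dvdz_congr; have -> : x - E y - (x' - E y) = x - x' by ring.
have h1 : (M%:Z %| F x - F x')%Z || (M%:Z %| F x - F x' - c%:Z)%Z.
  by rewrite -hEF -row hEF subrr dvdz0.
have h2 : (M%:Z %| F x + c%:Z - F x')%Z || (M%:Z %| F x + c%:Z - F x' - c%:Z)%Z.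
  by rewrite -hEF -row hEF [F x + c%:Z]addrC addrK subrr dvdz0 orbT.
case/orP: h1 => // /dvdzP[k ek]; case/orP: h2 => /dvdzP[l el]; last first.
  by apply/dvdzP; exists l; rewrite -el; ring.
have : 2 * c%:Z - M%:Z = 0; last by lia.
apply: (@dvdz_small M); last by lia.
by apply/dvdzP; exists (l - k - 1); lia.
Qed.

Lemma column_unique (x x' y : int) :
  (M%:Z %| y - F x)%Z || (M%:Z %| y - F x - c%:Z)%Z ->
  (M%:Z %| y - F x')%Z || (M%:Z %| y - F x' - c%:Z)%Z -> (a%:Z %| x - x')%Z.
Proof.
rewrite -!hEF => /dvdzP[k ek] /dvdzP[l el].
by apply/dvdzP; exists (k - l); rewrite mulrBl -ek -el; ring.
Qed.

(** The rows that contain a south endpoint. They form the subset H of Z/M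
    on which the whole classification rests. *)
Definition south_row (y : int) : bool := `[< exists x, (M%:Z %| y - F x)%Z >].

Lemma south_row_mod (y y' : int) :
  (M%:Z %| y - y')%Z -> south_row y = south_row y'.
Proof.
move=> yy'; apply: asbool_equiv_eq; have eqx x :
    (M%:Z %| y - F x)%Z = (M%:Z %| y' - F x)%Z.
  by apply: dvdz_congr; have -> : y - F x - (y' - F x) = y - y' by ring.
by split=> -[x]; [rewrite eqx|rewrite -eqx]; exists x.
Qed.

(** H and its translate H + c partition Z/M: a row contains an endpoint, which
    is a south or a north end; it cannot contain both kinds, since the columns
    of all its endpoints are congruent modulo a and so have the same south
    residue, whereas c is not 0 modulo M. *)
Lemma south_row_subc (y : int) : south_row (y - c%:Z) = ~~ south_row y.
Proof.
apply/asboolP/asboolPn => [[x hx] [x' hx']|].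
  have hx2 : (M%:Z %| y - F x - c%:Z)%Z by rewrite addrAC.
  have /matching_periodic/dvdzP[l el] : (a%:Z %| x - x')%Z.
    by apply: (@column_unique _ _ y); [rewrite hx2 orbT|rewrite hx'].
  case/dvdzP: hx => k ek; case/dvdzP: hx' => k' ek'.
  have : c%:Z = 0; last by lia.
  apply: (@dvdz_small M); last by lia.
  by apply/dvdzP; exists (k' - k - l); lia.
move=> nhy; exists (E y); have : (a%:Z %| E y - E y)%Z by rewrite subrr dvdz0.
by rewrite hEF => /orP[h|]; [case: nhy; exists (E y)|rewrite addrAC].
Qed.

Lemma south_row_addMc (y : int) (n : nat) :
  south_row (y + n%:Z * c%:Z) = odd n (+) south_row y.
Proof.
elim: n => [|n IH]; first by rewrite mul0r addr0.
rewrite oddS addNb -IH -[LHS]negbK -south_row_subc.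
by congr (~~ south_row _); lia.
Qed.

(** A translation by q c is the identity of Z/M, but it exchanges H and its
    complement q times. *)
Lemma matching_order_even : ~~ odd (additive_order M c).
Proof.
have := south_row_addMc 0 (additive_order M c).
rewrite (@south_row_mod _ 0); first by case: odd; case: south_row.
by rewrite subr0 add0r -dvdz_order.
Qed.

End Columns.

Section EvenOrder.
Hypotheses (a0 : (0 < a)%N) (hgcd : gcdn a (gcdn c d) = 1%N).
Hypothesis even_q : ~~ odd (additive_order M c).

(** If c were even, d would be too, hence a would be odd by the gcd hypothesis;
    but then a c is a multiple of 2a, so that q divides the odd number a. *)
Lemma odd_column_length : odd c.
Proof.
apply: contraNT even_q => even_c.
have q_dvd_a : (additive_order M c %| a)%N.
  rewrite dvdz_order; apply/dvdzP; exists (c./2)%:Z.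
  by have := odd_double_half c; rewrite (negPf even_c) -muln2; lia.
apply: (dvdn_odd q_dvd_a); apply: contraT => even_a.
suff : (2 %| gcdn a (gcdn c d))%N by rewrite hgcd.
rewrite !dvdn_gcd !dvdn2 even_a even_c /=.
by have := oddD c d; rewrite -hM oddM (negPf even_c) /= => <-.
Qed.

(** As c is odd, it remains to compare it with a: a common divisor of a and c
    also divides d = 2a - c. *)
Lemma coprime_column_length : coprime M c.
Proof.
rewrite coprimeMl coprime2n odd_column_length /= /coprime -dvdn1 -hgcd.
rewrite !dvdn_gcd dvdn_gcdl dvdn_gcdr /=.
have : (gcdn a c %| c + d)%N by rewrite -hM dvdn_mull // dvdn_gcdl.
by rewrite dvdn_addr // dvdn_gcdr.
Qed.

Lemma order_column_length : additive_order M c = M.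
Proof.
apply/eqP; rewrite eqn_dvd dvdz_order dvdz_mulr //=.
have := dvdnn (additive_order M c); rewrite dvdz_order.
by rewrite Gauss_dvdzl // coprimezE coprime_column_length.
Qed.

End EvenOrder.
End Matchings.

(** * Classification of the residues *)

Section Residues.
Local Open Scope ring_scope.
Variables a c : nat.
Local Notation M := (2 * a)%N.

(** The entry number k of the list [utilde] when it consists of a single
    block with bit u. *)
Definition south_residue (u : bool) (k : nat) : nat := (1 + (u + 2 * k) * c)%N.

(** Clause (i) of the parameterization, in terms of residues; the offset
    [j.+1] appears because column 1 has index 0 in ['I_a]. *)
Definition south_columns (u : bool) (sigma : 'S_a) (F : int -> int) : Prop :=
  forall (j : 'I_a) (s : int),
    (M%:Z %| F (j.+1%:Z + a%:Z * s) - (south_residue u (sigma j))%:Z)%Z.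

(** Clause (ii) of the parameterization: E is known modulo a from the endpoints,
    and v i tells which of the two lifts modulo 2a it is. *)
Definition row_halves (v : int -> bool) (E : int -> int) : Prop :=
  forall i : int, exists2 x : int,
    if v i then a%:Z <= x <= M%:Z - 1 else 0 <= x <= a%:Z - 1 &
    (M%:Z %| x - E i)%Z.

Lemma ord_dvdz_inj (j j' : 'I_a) : (a%:Z %| j%:Z - j'%:Z)%Z -> j = j'.
Proof.
move=> h; apply/ord_inj; have := ltn_ord j; have := ltn_ord j'.
by have := dvdz_small h; lia.
Qed.

Hypothesis a0 : (0 < a)%N.

Lemma columnP (x : int) : exists (j : 'I_a) (s : int), x = j.+1%:Z + a%:Z * s.
Proof.
have az : a%:Z != 0 :> int by lia.
have r0 := modz_ge0 (x - 1) az; have := divz_eq (x - 1) a%:Z.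
have : ((x - 1) %% a%:Z)%Z < a%:Z by apply: ltz_pmod; lia.
move: (_ %/ _)%Z (_ %% _)%Z r0 => s r r0 lt_r e.
have lt_j : (`|r| < a)%N by lia.
by exists (Ordinal lt_j), s => /=; lia.
Qed.

Lemma south_columns_unique (u : bool) (sigma : 'S_a) (F F' : int -> int) :
  south_columns u sigma F -> south_columns u sigma F' ->
  forall x, (M%:Z %| F x - F' x)%Z.
Proof.
move=> hF hF' x; have [j [s ->]] := columnP x.
have /dvdzP[k ek] := hF j s; have /dvdzP[l el] := hF' j s.
by apply/dvdzP; exists (k - l); rewrite mulrBl -ek -el; ring.
Qed.

Lemma row_halves_inj (v v' : int -> bool) (E : int -> int) :
  row_halves v E -> row_halves v' E -> v = v'.
Proof.
move=> h h'; apply/funext => i; have [x xv] := h i; have [x' xv'] := h' i.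
move=> /dvdzP[k ek] /dvdzP[l el].
have : x - x' = 0; last by case: (v i) xv; case: (v' i) xv' => //; lia.
apply: (@dvdz_small M); first by apply/dvdzP; exists (l - k); lia.
by case: (v i) xv; case: (v' i) xv'; lia.
Qed.

Lemma row_halves_ex (E : int -> int) : exists v, row_halves v E.
Proof.
have M0 : M%:Z != 0 :> int by lia.
exists (fun i => a%:Z <= (E i %% M%:Z)%Z) => i; exists (E i %% M%:Z)%Z.
  have r0 := modz_ge0 (E i) M0.
  have : (E i %% M%:Z)%Z < M%:Z by apply: ltz_pmod; lia.
  by case: ifP; lia.
apply/dvdzP; exists (- (E i %/ M%:Z)%Z); have := divz_eq (E i) M%:Z; lia.
Qed.

(** The columns fix E modulo a through the matching condition, and v then
    selects the half of [0, M - 1] in which its residue modulo M lies. *)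
Lemma row_halves_unique (v : int -> bool) (E E' F F' : int -> int) :
  matching a c E F -> matching a c E' F' ->
  (forall x, (M%:Z %| F x - F' x)%Z) ->
  row_halves v E -> row_halves v E' -> forall y, (M%:Z %| E y - E' y)%Z.
Proof.
move=> hEF hEF' FF' hv hv' y.
have /dvdzP[m em] : (a%:Z %| E y - E' y)%Z.
  have := hEF (E y) y; rewrite subrr dvdz0 hEF' => /esym.
  case/dvdzP: (FF' (E y)) => k ek.
  case/orP => /dvdzP[l el]; apply/orP; [left|right];
    by apply/dvdzP; exists (l + k); lia.
have [x xv /dvdzP[k ek]] := hv y; have [x' xv' /dvdzP[l el]] := hv' y.
have xx' : x - x' = 0.
  apply: (@dvdz_small a); last by case: (v y) xv xv'; lia.
  by apply/dvdzP; exists (2 * k - 2 * l + m); lia.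
by apply/dvdzP; exists (l - k); lia.
Qed.

Hypotheses (c0 : (0 < c)%N) (coMc : coprime M c).

Lemma dvdz_mulc (n : int) : (M%:Z %| n * c%:Z)%Z = (M%:Z %| n)%Z.
Proof. by rewrite Gauss_dvdzl // coprimezE. Qed.

(** As c is invertible modulo M, each residue is m c for exactly one m < M. In
    this coordinate m the translation by c becomes m |-> m + 1 and, M being even,
    the parity of m makes sense. *)
Lemma multiple_residue (z : int) :
  exists2 m : nat, (m < M)%N & (M%:Z %| z - m%:Z * c%:Z)%Z.
Proof.
have /coprimezP[[u v] /= uv] : coprimez M%:Z c%:Z by rewrite coprimezE.
have M0 : M%:Z != 0 :> int by lia.
have r0 := modz_ge0 (z * v) M0.
exists `|((z * v) %% M%:Z)%Z|%N.
  by rewrite -ltz_nat gez0_abs // ltz_pmod //; lia.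
rewrite gez0_abs //; apply/dvdzP.
exists (z * u + ((z * v) %/ M%:Z)%Z * c%:Z).
have := divz_eq (z * v) M%:Z.
move: (_ %/ _)%Z (_ %% _)%Z => k r e.
have -> : r = z * v - k * M%:Z by lia.
rewrite -{1}(mulr1 z) -uv; ring.
Qed.

Lemma south_residue_inj (u u' : bool) (k k' : nat) : (k < a)%N -> (k' < a)%N ->
  (M%:Z %| (south_residue u k)%:Z - (south_residue u' k')%:Z)%Z ->
  u = u' /\ k = k'.
Proof.
move=> ka ka'; rewrite [_ - _](_ : _ =
  ((u : nat)%:Z - (u' : nat)%:Z + 2 * (k%:Z - k'%:Z)) * c%:Z).
  rewrite dvdz_mulc => h; have := dvdz_small h.
  by case: u u' h => -[] /=; lia.
by rewrite /south_residue; lia.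
Qed.

Lemma south_residue_subc (u : bool) (k k' : nat) :
  ~~ (M%:Z %| (south_residue u k)%:Z - (south_residue u k')%:Z - c%:Z)%Z.
Proof.
rewrite [_ - _](_ : _ = (2 * (k%:Z - k'%:Z) - 1) * c%:Z).
  by rewrite dvdz_mulc; apply/negP => /dvdzP[l]; lia.
by rewrite /south_residue; lia.
Qed.

(** In the coordinate m of y - 1 - u c, the residues of index k are the even
    m = 2k and their translates by c are the odd m = 2k + 1. *)
Lemma south_residue_cover (u : bool) (y : int) : exists k : 'I_a,
  (M%:Z %| y - (south_residue u k)%:Z)%Z ||
  (M%:Z %| y - (south_residue u k)%:Z - c%:Z)%Z.
Proof.
have [m lt_m hm] := multiple_residue (y - 1 - (u : nat)%:Z * c%:Z).
have [k mk] : exists k, m = (2 * k)%N \/ m = (2 * k).+1%N.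
  by exists m./2; lia.
have lt_k : (k < a)%N by lia.
exists (Ordinal lt_k); apply/orP; case: mk hm => -> hm; [left|right].
  by apply: etrans hm; congr (_ %| _)%Z; rewrite /south_residue /=; lia.
by apply: etrans hm; congr (_ %| _)%Z; rewrite /south_residue /=; lia.
Qed.

Lemma south_columns_inj (u u' : bool) (sigma sigma' : 'S_a) (F : int -> int) :
  south_columns u sigma F -> south_columns u' sigma' F ->
  u = u' /\ sigma = sigma'.
Proof.
move=> h h'; have H (j : 'I_a) : u = u' /\ sigma j = sigma' j :> nat.
  apply: south_residue_inj; try exact: ltn_ord.
  have /dvdzP[k ek] := h j 0; have /dvdzP[l el] := h' j 0.
  by apply/dvdzP; exists (l - k); rewrite mulrBl -ek -el; ring.
split; first by have [] := H (Ordinal a0).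
by apply/permP => j; apply/ord_inj; have [] := H j.
Qed.

(** Since H alternates along multiples of c, it is the set of residues
    1 + (u + 2k) c for the bit u that makes 1 + u c belong to H. Two of the columns
    1, ..., a with the same south residue would meet a common row, hence be
    congruent modulo a; so the columns run through H bijectively. *)
Lemma south_columns_ex (d : nat) (E F : int -> int) :
  (0 < d)%N -> (M = c + d)%N -> c <> a -> matching a c E F ->
  exists (u : bool) (sigma : 'S_a), south_columns u sigma F.
Proof.
move=> d0 hM ca hEF; pose u := ~~ south_row a F 1.
have Fk (x : int) : exists k : 'I_a, (M%:Z %| F x - (south_residue u k)%:Z)%Z.
  have [k /orP[|Fx]] := south_residue_cover u (F x); first by exists k.
  have : south_row a F (F x).
    by apply/asboolP; exists x; rewrite subrr dvdz0.
  rewrite (@south_row_mod _ _ _ (1 + (u + k.*2).+1%:Z * c%:Z)).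
    rewrite (south_row_addMc c0 d0 hM ca hEF) oddS oddD odd_double addbF oddb.
    by rewrite /u; case: south_row.
  by apply: etrans Fx; congr (_ %| _)%Z; rewrite /south_residue -mul2n; lia.
have [s hs] := choice Fk.
have s_inj : injective (fun j : 'I_a => s j.+1%:Z).
  move=> j j' ss; apply: ord_dvdz_inj.
  have /dvdzP[k ek] := hs j.+1; have /dvdzP[l el] := hs j'.+1.
  rewrite (_ : _ - _ = j.+1%:Z - j'.+1%:Z); last by lia.
  apply: (column_unique hEF (y := F j.+1)); first by rewrite subrr dvdz0.
  by apply/orP; left; apply/dvdzP; exists (k - l); rewrite ss in ek; lia.
exists u, (perm s_inj) => j t; rewrite permE.
have /dvdzP[k ek] := hs j.+1.
have /(matching_periodic c0 d0 hM ca hEF)/dvdzP[l el] :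
    (a%:Z %| j.+1%:Z + a%:Z * t - j.+1%:Z)%Z.
  by apply/dvdzP; exists t; lia.
by apply/dvdzP; exists (k + l); lia.
Qed.

(** The residues of the a columns together with their translates by c exhaust
    Z/M without repetition, so that each row meets exactly one column class
    modulo a: this class is E modulo a, and v lifts it modulo M. *)
Lemma matching_ex (u : bool) (v : int -> bool) (sigma : 'S_a) :
  exists E F, [/\ matching a c E F, south_columns u sigma F & row_halves v E].
Proof.
have /choice[F hF] (x : int) : exists k : nat, exists (j : 'I_a) (s : int),
    x = j.+1%:Z + a%:Z * s /\ k = south_residue u (sigma j).
  by have [j [s e]] := columnP x; exists (south_residue u (sigma j)), j, s.
have colF (j : 'I_a) (s : int) :
    F (j.+1%:Z + a%:Z * s) = south_residue u (sigma j).
  have [j' [s' [e ->]]] := hF (j.+1%:Z + a%:Z * s).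
  suff -> : j = j' by [].
  apply: ord_dvdz_inj.
  by apply/dvdzP; exists (s' - s); lia.
pose on_row y (j : 'I_a) :=
  (M%:Z %| y - (south_residue u (sigma j))%:Z)%Z ||
  (M%:Z %| y - (south_residue u (sigma j))%:Z - c%:Z)%Z.
have row_ex y : exists j, on_row y j.
  have [k hk] := south_residue_cover u y.
  by exists (sigma^-1%g k); rewrite /on_row permKV.
have row_uniq y j j' : on_row y j -> on_row y j' -> j = j'.
  move=> hj hj'; apply/(@perm_inj _ sigma)/ord_inj.
  have no := south_residue_subc u.
  case/orP: hj => /dvdzP[k ek]; case/orP: hj' => /dvdzP[l el].
  - apply: (proj2 (@south_residue_inj u u _ _ _ _ _)); rewrite ?ltn_ord //.
    by apply/dvdzP; exists (l - k); lia.
  - case/negP: (no (sigma j) (sigma j')).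
    by apply/dvdzP; exists (l - k); lia.
  - case/negP: (no (sigma j') (sigma j)).
    by apply/dvdzP; exists (k - l); lia.
  - apply: (proj2 (@south_residue_inj u u _ _ _ _ _)); rewrite ?ltn_ord //.
    by apply/dvdzP; exists (l - k); lia.
have /choice[E hE] (y : int) : exists x : int, exists j : 'I_a,
    [/\ on_row y j, (a%:Z %| x - j.+1%:Z)%Z &
        if v y then a%:Z <= x <= M%:Z - 1 else 0 <= x <= a%:Z - 1].
  have [j hj] := row_ex y; have lt_j := ltn_ord j.
  (* column j.+1 shifted into [0, a - 1]; only j.+1 = a has to move, to 0 *)
  pose e : int := if (j.+1 == a)%N then 0 else j.+1%:Z.
  exists (if v y then e + a%:Z else e), j; split => //; last first.
    by rewrite /e; case: (v y); case: eqP; lia.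
  rewrite /e; case: (v y); case: eqP => ja; apply/dvdzP;
    [exists 0|exists 1|exists (-1)|exists 0]; lia.
exists E, (fun x => (F x)%:Z); split.
- move=> x y; have [j [hj /dvdzP[k ek] _]] := hE y.
  have [i [s ex]] := columnP x; rewrite [in RHS]ex colF -/(on_row y i).
  apply/idP/idP => [/dvdzP[l el]|hi].
    suff -> : i = j by [].
    apply: ord_dvdz_inj.
    by apply/dvdzP; exists (l + k - s); lia.
  rewrite ex (row_uniq _ _ _ hi hj).
  by apply/dvdzP; exists (s - k); lia.
- by move=> j s; rewrite colF subrr dvdz0.
- move=> y; have [j [_ _ hv]] := hE y.
  by exists (E y) => //; rewrite subrr dvdz0.
Qed.

End Residues.

(** * Strands *)

Lemma next_seq4 (T : eqType) (x y z t : T) : uniq [:: x; y; z; t] ->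
  [/\ next [:: x; y; z; t] x = y, next [:: x; y; z; t] y = z,
      next [:: x; y; z; t] z = t & next [:: x; y; z; t] t = x].
Proof.
rewrite /= !inE !negb_or => /and4P[/and3P[xy xz xt] /andP[yz yt] zt _].
rewrite /= !eqxx (eq_sym y x) (eq_sym z x) (eq_sym z y) !(eq_sym t).
by rewrite !(negPf xy, negPf xz, negPf xt, negPf yz, negPf yt, negPf zt).
Qed.

Section Strands.
Local Open Scope ring_scope.

Lemma connected_in_sym (P : arrangement) (u v : vertex) :
  connected_in P u v -> connected_in P v u.
Proof.
elim=> [x y Pxy||x y z _ yx _ zy]; last exact: rt_trans zy yx.
  by apply: rt_step; rewrite segC.
exact: rt_refl.
Qed.

(** In a graph whose vertices have only two edges, a bi-infinite walk that
    uses both edges at each of its vertices is a whole component: one can never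
    leave it. Closed cycles are covered too, as periodic walks. *)
Lemma strand_walk (P : arrangement) (f : int -> vertex) (n0 : int) :
  (forall n, P (seg (f n) (f (n + 1)))) ->
  (forall n e, P e -> e (f n) ->
     e = seg (f (n - 1)) (f n) \/ e = seg (f n) (f (n + 1))) ->
  [set e | P e /\ exists2 v, e v & connected_in P (f n0) v] =
  range (fun n => seg (f n) (f (n + 1))).
Proof.
move=> Pf degree2.
have connD (n : int) (k : nat) : connected_in P (f n) (f (n + k%:Z)).
  elim: k => [|k IH]; first by rewrite addr0; exact: rt_refl.
  apply: rt_trans IH _; apply: rt_step.
  by have -> : n + k.+1%:Z = n + k%:Z + 1 by lia.
have conn (n m : int) : connected_in P (f n) (f m).
  have [nm|mn] := lerP n m.
    have -> : m = n + `|m - n|%N%:Z by lia.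
    exact: connD.
  apply: connected_in_sym; have -> : n = m + `|n - m|%N%:Z by lia.
  exact: connD.
have reach u v : connected_in P u v -> (exists n, u = f n) -> exists n, v = f n.
  elim=> // [x y Pxy [n xn]|x y z _ IH1 _ IH2 /IH1/IH2//].
  have xin : seg x y (f n) by left.
  case: (degree2 n _ Pxy xin) => /seg_inj[] [].
  - by move=> _ ->; exists n.
  - by move=> _ ->; exists (n - 1).
  - by move=> _ ->; exists (n + 1).
  - by move=> _ ->; exists n.
apply/seteqP; split => [e [Pe [v ev]]|e [n _ <-]].
  move=> /reach -/(_ (ex_intro _ n0 erefl)) [n vn].
  rewrite vn in ev; case: (degree2 n e Pe ev) => ->; last by exists n.
  by exists (n - 1) => //; rewrite subrK.
by split=> //; exists (f n) => //; left.
Qed.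

Variables a c : nat.
Local Notation M := (2 * a)%N.

Definition tour_corner (k i w m : int) (r : nat) : vertex :=
  match r with
  | 0 => (k + w * m, i)
  | 1 => (k + w * m, i + c%:Z)
  | 2 => (k + w * m + a%:Z, i + c%:Z)
  | _ => (k + w * m + a%:Z, i)
  end.

(** The walk that goes north, east, south and east (or back west) between rows
    i and i + c, drifting by w every four steps. The drift w = 0 yields a
    rectangle and w = M an accordion, so that the two kinds of strands are
    treated at once. *)
Definition tour (k i w n : int) : vertex :=
  tour_corner k i w (n %/ 4)%Z `|(n %% 4)%Z|.

Lemma int_mod4 (n : int) : exists m : int,
  [\/ n = 4 * m, n = 4 * m + 1, n = 4 * m + 2 | n = 4 * m + 3].
Proof.
exists (n %/ 4)%Z.
have [h|[h|[h|h]]] : (n %% 4)%Z = 0 \/ (n %% 4)%Z = 1 \/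
    (n %% 4)%Z = 2 \/ (n %% 4)%Z = 3 by lia.
- by apply: Or41; lia.
- by apply: Or42; lia.
- by apply: Or43; lia.
- by apply: Or44; lia.
Qed.

Lemma tourE (k i w m : int) : [/\ tour k i w (4 * m) = (k + w * m, i),
  tour k i w (4 * m + 1) = (k + w * m, i + c%:Z),
  tour k i w (4 * m + 2) = (k + w * m + a%:Z, i + c%:Z) &
  tour k i w (4 * m + 3) = (k + w * m + a%:Z, i)].
Proof.
have H (r : nat) : (r < 4)%N ->
    tour k i w (4 * m + r%:Z) = tour_corner k i w m r.
  by move=> r4; congr tour_corner; lia.
split; [rewrite -[4 * m]addr0| | |].
- exact: (H 0%N).
- exact: (H 1%N).
- exact: (H 2%N).
- exact: (H 3%N).
Qed.

Hypotheses (a0 : (0 < a)%N) (c0 : (0 < c)%N).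

Section TourShape.
Variables k i w : int.
Local Notation f := (tour k i w).

Lemma tour_rectangle :
  w = 0 -> rectangle (range (fun n => seg (f n) (f (n + 1)))).
Proof.
move=> w0.
pose v1 : vertex := (k, i); pose v2 : vertex := (k, i + c%:Z).
pose v3 : vertex := (k + a%:Z, i + c%:Z); pose v4 : vertex := (k + a%:Z, i).
have [n12 n13 n14] : [/\ v1 != v2, v1 != v3 & v1 != v4].
  by split; apply/eqP => -[]; clear -a0 c0; lia.
have [n23 n24 n34] : [/\ v2 != v3, v2 != v4 & v3 != v4].
  by split; apply/eqP => -[]; clear -a0 c0; lia.
have fE m : [/\ f (4 * m) = v1, f (4 * m + 1) = v2,
    f (4 * m + 2) = v3 & f (4 * m + 3) = v4].
  by have := tourE k i w m; rewrite w0 mul0r addr0.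
pose s := [:: v1; v2; v3; v4].
have s_uniq : uniq s.
  by rewrite /= !inE !negb_or n12 n13 n14 n23 n24 n34.
have [next1 next2 next3 next4] := next_seq4 s_uniq.
have edgeE m : [/\ seg (f (4 * m)) (f (4 * m + 1)) = seg v1 v2,
    seg (f (4 * m + 1)) (f (4 * m + 1 + 1)) = seg v2 v3,
    seg (f (4 * m + 2)) (f (4 * m + 2 + 1)) = seg v3 v4 &
    seg (f (4 * m + 3)) (f (4 * m + 3 + 1)) = seg v4 v1].
  have -> : 4 * m + 1 + 1 = 4 * m + 2 by ring.
  have -> : 4 * m + 2 + 1 = 4 * m + 3 by ring.
  have -> : 4 * m + 3 + 1 = 4 * (m + 1) by ring.
  by have [-> -> -> ->] := fE m; have [-> _ _ _] := fE (m + 1).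
exists s; split=> //.
apply/seteqP; split => [e [n _ <-]|e [v + ->]].
  have [m hn] := int_mod4 n; have [e1 e2 e3 e4] := edgeE m.
  case: hn => ->; [exists v1|exists v2|exists v3|exists v4];
    by rewrite ?inE ?eqxx ?orbT ?next1 ?next2 ?next3 ?next4.
have [e1 e2 e3 e4] := edgeE 0.
rewrite !inE => /or4P[] /eqP ->; rewrite ?next1 ?next2 ?next3 ?next4.
- by exists (4 * 0).
- by exists (4 * 0 + 1).
- by exists (4 * 0 + 2).
- by exists (4 * 0 + 3).
Qed.

Lemma tour_accordion :
  w = M%:Z -> horizontal_accordion (range (fun n => seg (f n) (f (n + 1)))).
Proof.
move=> wM; split; last first.
  exists f; split=> // n; have -> : 4 * n + 4 = 4 * (n + 1) by ring.
  have [-> -> -> ->] := tourE k i w n; have [-> _ _ _] := tourE k i w (n + 1).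
  have wn : w * (n + 1) = w * n + M%:Z by rewrite mulrDr mulr1 {2}wM.
  rewrite /south_to_north /west_to_east /north_to_south /= wn.
  by split; split=> //; lia.
pose g (n : nat) := seg (f (4 * n%:Z)) (f (4 * n%:Z + 1)).
have g_inj : injective g.
  move=> n m; rewrite /g; have [-> -> _ _] := tourE k i w n%:Z.
  have [-> -> _ _] := tourE k i w m%:Z.
  by case/vertical_seg_inj => //; rewrite wM; clear -a0; nia.
apply: (@sub_infinite_set _ (range g)).
  by move=> _ [n _ <-]; exists (4 * n%:Z).
rewrite (eq_finite_set (inj_card_eq _)); first exact: infinite_nat.
by move=> n m _ _; exact: g_inj.
Qed.

End TourShape.

Section PatternStrands.
Variable d : nat.
Hypotheses (d0 : (0 < d)%N) (hM : (M = c + d)%N) (ca : c <> a).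
Variables E F : int -> int.
Hypothesis hEF : matching a c E F.
Local Notation P := (pattern a c E F).

Section Tour.
(** [hw] records the position of the horizontal stitches of row i relative to
    those of row i + c: either aligned with them or shifted by half a period. *)
Variables k i w : int.
Hypotheses (hF : (M%:Z %| i - F k)%Z) (hN : (M%:Z %| k - E (i + c%:Z))%Z).
Hypothesis hw : w = 0 /\ (M%:Z %| k - E i)%Z \/
                w = M%:Z /\ (M%:Z %| k + a%:Z - E i)%Z.

Local Notation f := (tour k i w).

(** All columns met by the tour are congruent modulo a and so have the same
    vertical stitches. *)
Lemma tour_stitches (m : int) :
  [/\ vertical_arrangement a c F (seg (f (4 * m)) (f (4 * m + 1))),
      horizontal_arrangement a E (seg (f (4 * m + 1)) (f (4 * m + 2))),
      vertical_arrangement a c F (seg (f (4 * m + 2)) (f (4 * m + 3))) &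
      horizontal_arrangement a E (seg (f (4 * m + 3)) (f (4 * m + 4)))].
Proof.
have -> : 4 * m + 4 = 4 * (m + 1) by lia.
have [-> -> -> ->] := tourE k i w m; have [-> _ _ _] := tourE k i w (m + 1).
have wM : exists t, w * m = t * M%:Z.
  by case: hw => -[-> _]; [exists 0; rewrite !mul0r|exists m; rewrite mulrC].
have [t wt] := wM; have MZ : M%:Z = 2 * a%:Z by [].
have col (s : int) : (M%:Z %| i - F (k + s * a%:Z))%Z.
  have /(matching_periodic c0 d0 hM ca hEF)/dvdzP[l el] :
    (a%:Z %| k - (k + s * a%:Z))%Z by apply/dvdzP; exists (- s); ring.
  case/dvdzP: hF => n en; apply/dvdzP; exists (n + l).
  by rewrite mulrDl -en -el; ring.
split.
- exists (k + w * m), i; split=> //; apply: etrans (col (2 * t)).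
  by congr (_ %| _ - F _)%Z; rewrite wt MZ; ring.
- exists (k + w * m), (i + c%:Z); split=> //.
  case/dvdzP: hN => n en; apply/dvdzP; exists (n + t).
  by rewrite mulrDl -en -wt; ring.
- exists (k + w * m + a%:Z), i; rewrite segC; split=> //.
  apply: etrans (col (2 * t + 1)).
  by congr (_ %| _ - F _)%Z; rewrite wt MZ; ring.
- case: hw => -[w0 /dvdzP[n en]].
    exists k, i; rewrite segC w0 !mul0r !addr0; split=> //.
    by apply/dvdzP; exists n.
  exists (k + w * m + a%:Z), i; split.
    by apply/dvdzP; exists (n + t); rewrite mulrDl -en -wt; ring.
  by congr (seg _ (_, _)); rewrite w0 MZ; ring.
Qed.

(** The stitches of the tour are alternately vertical and horizontal, and a
    vertex lies on only one stitch of each direction. *)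
Lemma strand_tour (n0 : int) :
  [set e | P e /\ exists2 v, e v & connected_in P (f n0) v] =
  range (fun n => seg (f n) (f (n + 1))).
Proof.
have kind n :
    vertical_arrangement a c F (seg (f n) (f (n + 1))) /\
      horizontal_arrangement a E (seg (f (n - 1)) (f n)) \/
    horizontal_arrangement a E (seg (f n) (f (n + 1))) /\
      vertical_arrangement a c F (seg (f (n - 1)) (f n)).
  have [m hn] := int_mod4 n; have [h1 h2 h3 h4] := tour_stitches m.
  have [_ _ _] := tour_stitches (m - 1).
  have -> : 4 * (m - 1) + 3 = 4 * m - 1 by lia.
  have -> : 4 * (m - 1) + 4 = 4 * m by lia.
  have e1 : 4 * m + 1 + 1 = 4 * m + 2 by lia.
  have e2 : 4 * m + 2 + 1 = 4 * m + 3 by lia.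
  have e3 : 4 * m + 3 + 1 = 4 * m + 4 by lia.
  have p1 : 4 * m + 1 - 1 = 4 * m by lia.
  have p2 : 4 * m + 2 - 1 = 4 * m + 1 by lia.
  have p3 : 4 * m + 3 - 1 = 4 * m + 2 by lia.
  move=> h5; case: hn => ->; rewrite ?e1 ?e2 ?e3 ?p1 ?p2 ?p3.
  - by left.
  - by right.
  - by left.
  - by right.
apply: strand_walk => [n|n e].
  by case: (kind n) => -[h _]; [right|left].
have cM : (c < M)%N by rewrite hM -[X in (X < _)%N]addn0 ltn_add2l.
have xl : seg (f (n - 1)) (f n) (f n) by right.
have xr : seg (f n) (f (n + 1)) (f n) by left.
case: (kind n) => -[hr hl] [he|he] en.
- by left; exact: (horizontal_stitch_unique a0 he hl en xl).
- by right; exact: (vertical_stitch_unique c0 cM he hr en xr).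
- by right; exact: (horizontal_stitch_unique a0 he hr en xr).
- by left; exact: (vertical_stitch_unique c0 cM he hl en xl).
Qed.

End Tour.

(** The column of the given vertex has a vertical stitch from some row i to
    row i + c ending there. By periodicity the endpoints of these two rows are
    in the same columns, so the horizontal stitches of the two rows either
    coincide or alternate. *)
Lemma pattern_strand (S : arrangement) :
  strand P S -> rectangle S \/ horizontal_accordion S.
Proof.
case=> -[x y] [e Pe eu] ->.
have south_or_north : (M%:Z %| y - F x)%Z || (M%:Z %| y - F x - c%:Z)%Z.
  case: Pe => [he|ve].
    have : endpoints (horizontal_arrangement a E) (x, y) by exists e.
    by rewrite endpoints_horizontal /= hEF.
  have : endpoints (vertical_arrangement a c F) (x, y) by exists e.
  by rewrite endpoints_vertical.
have [i [hi yi]] : exists i, (M%:Z %| i - F x)%Z /\ (y = i \/ y = i + c%:Z).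
  case/orP: south_or_north => h; first by exists y; split; [|left].
  by exists (y - c%:Z); rewrite subrK addrAC; split; [|right].
have [k [hN xk]] : exists k : int,
    (M%:Z %| k - E (i + c%:Z))%Z /\ (x = k \/ x = k + a%:Z).
  have : (a%:Z %| x - E (i + c%:Z))%Z.
    by rewrite hEF addrAC addrK hi orbT.
  rewrite dvdz_half => /orP[h|h]; first by exists x; split; [|left].
  by exists (x - a%:Z); rewrite subrK addrAC; split; [|right].
have xka : (a%:Z %| k - x)%Z.
  by case: xk => ->; apply/dvdzP; [exists 0|exists (-1)]; ring.
have hF : (M%:Z %| i - F k)%Z.
  have /dvdzP[l el] := matching_periodic c0 d0 hM ca hEF xka.
  case/dvdzP: hi => n en; apply/dvdzP; exists (n - l).
  by rewrite mulrBl -en -el; ring.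
have : (a%:Z %| k - E i)%Z by rewrite hEF hF.
rewrite dvdz_half => row_i.
have [w hw] : exists w, w = 0 /\ (M%:Z %| k - E i)%Z \/
                        w = M%:Z /\ (M%:Z %| k + a%:Z - E i)%Z.
  case/orP: row_i => [h|/dvdzP[n en]]; first by exists 0; left.
  exists M%:Z; right; split=> //; apply/dvdzP; exists (n + 1).
  by rewrite mulrDl -en -[M%:Z]/(2 * a%:Z); ring.
have [n0 ->] : exists n0, (x, y) = tour k i w n0.
  have [f0 f1 f2 f3] := tourE k i w 0.
  rewrite !mulr0 !addr0 in f0 f1 f2 f3.
  case: xk => ->; case: yi => ->.
  - by exists 0.
  - by exists (0 + 1).
  - by exists (0 + 3).
  - by exists (0 + 2).
rewrite (strand_tour hF hN hw); case: (hw) => -[w0 _].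
  by left; apply: tour_rectangle.
by right; apply: tour_accordion.
Qed.

End PatternStrands.
End Strands.

(** * The parameterization *)

Section Psi.
Local Open Scope ring_scope.
Variables a c d : nat.
Local Notation M := (2 * a)%N.
Hypotheses (a0 : (0 < a)%N) (c0 : (0 < c)%N) (d0 : (0 < d)%N).
Hypotheses (hM : (M = c + d)%N) (ca : c <> a).
Hypotheses (coMc : coprime M c) (qM : additive_order M c = M).
Local Notation q := (additive_order M c).

(** As q = M, the parameter u consists of a single bit. *)
Lemma block_count : (M %/ q = 1)%N.
Proof. by rewrite qM divnn; case: a a0. Qed.

Definition block0 : 'I_(M %/ q) := cast_ord (esym block_count) ord0.

Lemma eq_block0 (i : 'I_(M %/ q)) : i = block0.
Proof.
apply/ord_inj => /=; have := ltn_ord i; rewrite {2}block_count.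
by case: (i : nat).
Qed.

Lemma nth_utilde (u : {ffun 'I_(M %/ q) -> bool}) (k : nat) : (k < a)%N ->
  nth 0%N (utilde u) k = south_residue c (u block0) k.
Proof.
move=> ka; have enum1 : enum 'I_(M %/ q) = [:: block0].
  have : size (enum 'I_(M %/ q)) = 1%N by rewrite size_enum_ord block_count.
  by case: (enum _) => [|i []] // _; rewrite (eq_block0 i).
have half : (q %/ 2 = a)%N by rewrite qM mulKn.
rewrite /utilde enum1 /= cats0 /uhat half (nth_map 0%N) ?size_iota //.
by rewrite nth_iota.
Qed.

Lemma south_endpoints_pattern (E F : int -> int) :
  south_endpoints c (pattern a c E F) = [set p | (M%:Z %| p.2 - F p.1)%Z].
Proof.
by apply/seteqP; split => -[x y]; rewrite /south_endpoints /= pattern_vertical.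
Qed.

(** Clause (i) says that, over each residue of x modulo a, the south
    endpoints are one prescribed class modulo M. *)
Lemma south_columnsP (u : {ffun 'I_(M %/ q) -> bool}) (sigma : 'S_a)
    (E F : int -> int) :
  south_endpoints c (pattern a c E F) =
    [set p | exists (j : 'I_a) (s t : int),
       p = (j.+1%:Z + a%:Z * s,
            (nth 0%N (utilde u) (sigma j))%:Z + M%:Z * t)] <->
  south_columns c (u block0) sigma F.
Proof.
rewrite south_endpoints_pattern; split.
  move=> /seteqP[h _] j s; move ex : (j.+1%:Z + a%:Z * s) => x.
  have [] := h (x, F x); first by rewrite /= subrr dvdz0.
  move=> j' [s' [t [xj' Fx]]]; rewrite Fx nth_utilde //.
  have -> : j = j'.
    by apply: ord_dvdz_inj; apply/dvdzP; exists (s' - s); lia.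
  by apply/dvdzP; exists t; lia.
move=> hF; apply/seteqP; split => [[x y] /= /dvdzP[k ek]|_ [j [s [t ->]]] /=].
  have [j [s xj]] := columnP a0 x; exists j, s.
  have /dvdzP[l el] := hF j s; exists (k + l); rewrite nth_utilde //.
  by rewrite xj in ek *; congr (_, _); lia.
rewrite nth_utilde //; have /dvdzP[l el] := hF j s.
by apply/dvdzP; exists (t - l); lia.
Qed.

Lemma psi_specP (u : {ffun 'I_(M %/ q) -> bool}) (v : int -> bool)
    (sigma : 'S_a) (P : arrangement) :
  psi_spec d ((u, v, sigma) : parameter a c) P <->
  exists E F, [/\ P = pattern a c E F, matching a c E F,
    south_columns c (u block0) sigma F & row_halves a v E].
Proof.
have rows E F : (forall i : int, exists x : int,
     (if v i then a%:Z <= x <= M%:Z - 1 else 0 <= x <= a%:Z - 1) /\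
     pattern a c E F (seg (x, i) (x + a%:Z, i))) <-> row_halves a v E.
  split=> h i; have [x] := h i.
    by case=> xv /(pattern_horizontal c a0) xE; exists x.
  by move=> xv xE; exists x; split=> //; apply/pattern_horizontal.
rewrite /psi_spec; split.
  case=> /(hitomezashiP _ a0 hM)[E [F [-> hEF]]] /south_columnsP hF /rows hE.
  by exists E, F.
case=> E [F [-> hEF hF hE]]; split; last exact/rows.
  by apply/(hitomezashiP _ a0 hM); exists E, F.
exact/south_columnsP.
Qed.

Lemma psi_spec_ex (y : parameter a c) : exists P, psi_spec d y P.
Proof.
case: y => -[u v] sigma.
have [E [F [hEF hF hE]]] := matching_ex a0 c0 coMc (u block0) v sigma.
by exists (pattern a c E F); apply/psi_specP; exists E, F.
Qed.

Lemma psi_spec_unique (y : parameter a c) (P P' : arrangement) :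
  psi_spec d y P -> psi_spec d y P' -> P = P'.
Proof.
case: y => -[u v] sigma /psi_specP[E [F [-> hEF hF hE]]].
move=> /psi_specP[E' [F' [-> hEF' hF' hE']]].
have FF' := south_columns_unique a0 hF hF'.
by apply: eq_pattern => //; exact: (row_halves_unique a0 hEF hEF' FF' hE hE').
Qed.

(** A pattern determines its south ends and west ends, hence the residues of
    F and E modulo M, from which u, sigma and v can be read off. *)
Lemma psi_spec_inj (y y' : parameter a c) (P : arrangement) :
  psi_spec d y P -> psi_spec d y' P -> y = y'.
Proof.
case: y y' => -[u v] sigma [[u' v'] sigma'].
move=> /psi_specP[E [F [-> hEF hF hE]]] /psi_specP[E' [F' [eqP hEF' hF' hE']]].
have FF' x : (M%:Z %| F x - F' x)%Z.
  apply/(pattern_vertical a0 c0 E' F'); rewrite -eqP.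
  by apply/pattern_vertical; rewrite // subrr dvdz0.
have {}hF' : south_columns c (u' block0) sigma' F.
  move=> j s; have /dvdzP[k ek] := hF' j s.
  have /dvdzP[l el] := FF' (j.+1%:Z + a%:Z * s).
  by apply/dvdzP; exists (k + l); lia.
have {}hE' : row_halves a v' E.
  move=> i; have [x xv xE'] := hE' i; exists x => //.
  by apply/(pattern_horizontal c a0 E F); rewrite eqP; apply/pattern_horizontal.
have [uu' ->] := south_columns_inj a0 c0 coMc hF hF'.
rewrite (row_halves_inj a0 hE hE'); congr (_, _, _).
by apply/ffunP => i; rewrite (eq_block0 i).
Qed.

Lemma psi_spec_cover (P : arrangement) :
  hitomezashi a a c d P -> exists y : parameter a c, psi_spec d y P.
Proof.
move=> /(hitomezashiP _ a0 hM)[E [F [-> hEF]]].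
have [u [sigma hF]] := south_columns_ex a0 c0 coMc d0 hM ca hEF.
have [v hE] := row_halves_ex a0 E.
exists ([ffun=> u], v, sigma); apply/psi_specP; exists E, F.
by split=> //; rewrite ffunE.
Qed.

Lemma psiP (y : parameter a c) : psi_spec d y (psi d y).
Proof. exact: getPex (psi_spec_ex y). Qed.

Lemma psi_bij :
  set_bij [set: parameter a c] [set P | hitomezashi a a c d P] (@psi a c d).
Proof.
split=> [y _|y y' _ _ eq_psi|P /psi_spec_cover[y hy]].
- by have := psiP y; case: y => -[u v] sigma [].
- by apply: psi_spec_inj (psiP y) _; rewrite eq_psi; exact: psiP.
- by exists y => //; exact: psi_spec_unique (psiP y) hy.
Qed.

(** A parameter is a bi-infinite binary sequence together with finite data; the
    latter are stored as a singleton on the even places of a sequence indexed by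
    nat, the former on the odd places. *)
Lemma card_parameter : [set: parameter a c] #= [set: nat -> bool].
Proof.
rewrite card_eq_le; apply/andP; split.
  apply/pcard_injP.
  exists (fun y n => if odd n then y.1.2 (odflt 0 (unpickle n./2))
                     else n./2 == pickle (y.1.1, y.2)).
  move=> [[u v] sigma] [[u' v'] sigma'] _ _ /= eq_code.
  have := congr1 (@^~ (pickle (u, sigma)).*2) eq_code.
  rewrite /= odd_double doubleK eqxx => /esym/eqP/(pcan_inj pickleK)[-> ->].
  congr (_, _, _); apply/funext => i.
  have := congr1 (@^~ (pickle i).*2.+1) eq_code.
  by rewrite /= odd_double /= uphalf_double pickleK.
pose f (g : nat -> bool) : parameter a c :=
  ([ffun=> false], fun i => g `|i|%N, 1%g).
have f_inj : {in [set: nat -> bool] &, injective f}.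
  move=> g g' _ _ /pair_equal_spec[/pair_equal_spec[_ gg'] _].
  by apply/funext => n; have := congr1 (@^~ n%:Z) gg'.
rewrite -(card_le_eql (inj_card_eq f_inj)).
exact: subset_card_le.
Qed.

End Psi.

Theorem theorem3p11 (a c d : nat)
  (ha : (0 < a)%N) (hc : (0 < c)%N) (hd : (0 < d)%N)
  (hne1 : ~ (a = 1%N /\ c = 1%N /\ d = 1%N))
  (hgcd : gcdn a (gcdn c d) = 1%N)
  (hM : (2 * a = c + d)%N) :
  (odd (additive_order (2 * a) c) ->
     [set P | hitomezashi a a c d P] = set0) /\
  (~~ odd (additive_order (2 * a) c) ->
     [/\ forall P, hitomezashi a a c d P ->
           forall S, strand P S -> rectangle S \/ horizontal_accordion S,
         forall y : parameter a c, exists! P, psi_spec d y P,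
         set_bij [set: parameter a c] [set P | hitomezashi a a c d P]
           (@psi a c d) &
         [set P | hitomezashi a a c d P] #= [set: nat -> bool]]).
Proof.
have ca : c <> a.
  move=> ca; apply: hne1; have da : d = a by lia.
  by move: hgcd; rewrite da ca !gcdnn => ->.
split=> [odd_q|even_q].
  apply/seteqP; split=> // P /(hitomezashiP _ ha hM)[E [F [_ hEF]]].
  by move: (matching_order_even hc hd hM ca hEF); rewrite odd_q.
have coMc := coprime_column_length hc hd hM ha hgcd even_q.
have qM := order_column_length hc hd hM ha hgcd even_q.
have bij := psi_bij ha hc hd hM ca coMc qM.
split=> //.
- move=> P /(hitomezashiP _ ha hM)[E [F [-> hEF]]] S.
  exact: (pattern_strand ha hc hd hM ca hEF).
- move=> y; have [P hP] := psi_spec_ex ha hc hd hM ca coMc qM y.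
  exists P; split=> // P'.
  exact: (psi_spec_unique ha hc hd hM ca coMc qM hP).
- apply: card_eq_trans (card_parameter a c).
  by apply: card_esym; apply/card_set_bijP; exists (@psi a c d).
Qed.
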